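(* Let $p(n)$ be the $n$-th prime number. The set of all primes of the form $p(p(n))$, $n=1,2,\ldots$, contains $(k,\epsilon,\{1\})$-APs for every $k\ge 3$ and $\epsilon>0$.
   Context: For $k\in\mathbb{N}$ and $\epsilon>0$, a set $Q\subset\mathbb{R}$ is a $(k,\epsilon,\{1\})$-AP if there exist $t\in\mathbb{R}$ and $\Delta>0$ such that, with $P=\{t+\Delta x : x=0,1,\ldots,k-1\}$, we have $\#Q=\#P$ and $$\sup_{x\in P}\inf_{y\in Q}|x-y|\le\epsilon\Delta.$$ A set $F\subseteq \mathbb{R}$ contains $(k,\epsilon,\{1\})$-APs if some subset $Q\subseteq F$ is a $(k,\epsilon,\{1\})$-AP. *)

(* Defs.v *)
From mathcomp Require Import all_boot all_order all_algebra.
From mathcomp Require Import all_classical all_reals.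

Set Implicit Arguments.
Unset Strict Implicit.
Unset Printing Implicit Defensive.

Import Order.TTheory GRing.Theory Num.Theory.

Local Open Scope classical_set_scope.
Local Open Scope ring_scope.

Lemma ex_prime_above (m : nat) : exists q, (m < q)%N && prime q.
Proof. by have [q mq pq] := prime_above m; exists q; rewrite mq. Qed.

Definition next_prime (m : nat) : nat := ex_minn (ex_prime_above m).

(* Indexing starts at 1: nth_prime 1 = 2, nth_prime 2 = 3, and so on;
   nth_prime 0 = 0 is a dummy value. *)
Definition nth_prime (n : nat) : nat := iter n next_prime 0%N.

Lemma nth_primeP (n : nat) : (0 < n)%N ->
  prime (nth_prime n) /\ count prime (iota 0 (nth_prime n)) = n.-1.
Proof.
case: n => // n _; elim: n => [|n [IHp IHc]].
  rewrite /nth_prime /= /next_prime; case: ex_minnP => q /andP[_ pq] qmin.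
  have -> : q = 2 by apply/eqP; rewrite eqn_leq prime_gt1 // qmin.
  by [].
rewrite /nth_prime iterS -/(nth_prime n.+1) /next_prime.
case: ex_minnP => q /andP[ltq pq] qmin; split=> //.
have no_prime :
    count prime (iota (nth_prime n.+1).+1 (q - (nth_prime n.+1).+1)) = 0%N.
  apply/eqP; rewrite -leqn0 leqNgt -has_count; apply/hasPn => r.
  rewrite mem_iota subnKC // => /andP[lr rq].
  by apply/negP => pr; move: rq; rewrite ltnNge qmin // lr.
rewrite -(subnKC ltq) iotaD count_cat add0n no_prime addn0.
by rewrite -addn1 iotaD count_cat IHc /= add0n IHp addn0 addn1.
Qed.

Section ApproximateAP.
Variable R : realType.

Definition arith_prog (k : nat) (t Delta : R) : set R :=
  [set t + Delta * x%:R | x in `I_k].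

(* For k > 0 the cardinality condition makes Q finite and nonempty, so sup and
   inf below are the suprema and infima of nonempty bounded sets. *)
Definition is_approx_AP (k : nat) (eps : R) (Q : set R) : Prop :=
  exists t Delta : R,
    [/\ 0 < Delta,
        (Q #= arith_prog k t Delta)%card &
        sup [set inf [set `|x - y| | y in Q] | x in arith_prog k t Delta]
          <= eps * Delta].

Definition contains_approx_AP (k : nat) (eps : R) (F : set R) : Prop :=
  exists2 Q : set R, Q `<=` F & is_approx_AP k eps Q.

Definition prime_indexed_primes : set R :=
  [set (nth_prime (nth_prime n))%:R | n in [set n : nat | (1 <= n)%N]].

End ApproximateAP.

Arguments prime_indexed_primes R : clear implicits.

(* Main.v *)
Require Import Defs.
From mathcomp Require Import all_boot all_order all_algebra.
From mathcomp Require Import all_classical all_reals.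
From mathcomp Require Import zify.

Import Order.TTheory GRing.Theory Num.Theory.
Local Open Scope ring_scope.

(** Sets of integers without approximate progressions are polynomially sparse,
    whereas the primes of prime index are not.

    Sparsity ([count_without_cell_AP]): cut an interval into [k * m] equal
    cells, [k] groups of [m]. For each [j], the [j]-th cells of the [k] groups
    are in arithmetic progression, with a step of [m] cell widths. A set that
    meets all of them contains a point within one width of each term of a
    progression, which is an approximate progression as soon as
    [m > eps^-1]. Otherwise each [j] has an empty cell, so at most
    [m * (k - 1)] of the [k * m] cells are met, and iterating inside the cells
    leaves at most [(m * (k - 1)) ^ n] points in an interval of length
    [(k * m) ^ n]: the counting function is bounded by a power with an
    exponent smaller than 1.

    Density ([prime_of_prime_index_dense]): the number of primes of prime
    index below [x] is [prime_pi] applied twice, up to a shift by one, and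
    the central binomial coefficient gives a Chebyshev bound: [prime_pi x] is
    at least a constant times [x / log x] for large [x]. For [x = (k * m) ^ n] the count
    thus exceeds [(k * m) ^ n / (C * n ^ 2)], which contradicts sparsity for
    large [n] because [(k / (k - 1)) ^ n] outgrows [C * n ^ 2]. *)

(** * Sparsity of sets without approximate progressions *)

Section Counting.
Local Open Scope nat_scope.

Lemma count_iota_blocks (F : pred nat) (a N w : nat) :
  count F (iota a (N * w)) = \sum_(i < N) count F (iota (a + i * w) w).
Proof.
elim: N => [|N IH]; first by rewrite big_ord0.
by rewrite big_ord_recr /= mulSn addnC iotaD count_cat IH.
Qed.

Lemma sum_bounded_one_zero (n B : nat) (f : 'I_n.+1 -> nat) (i : 'I_n.+1) :
  (forall x, f x <= B) -> f i = 0 -> \sum_x f x <= n * B.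
Proof.
move=> fB fi; rewrite (bigD1 i) //= fi add0n.
apply: (@leq_trans (\sum_(x < n.+1 | x != i) B)); first exact: leq_sum.
by rewrite sum_nat_const (cardC1 i) card_ord.
Qed.

(** The integral form of an approximate progression: cells of width [w] whose
    left ends have common difference [m * w], so that the tolerance is the
    fraction [1 / m] of the step. *)
Definition has_cell_AP (F : pred nat) (k m : nat) : Prop :=
  exists a w, 0 < w /\ exists f : nat -> nat, forall x, x < k ->
    [/\ F (f x), a + x * (m * w) <= f x & f x < a + x * (m * w) + w].

(** The cells are indexed by a group [x < b.+1] and an offset [j < m]. Summing
    over the groups first, the absence of a progression with offset [j] makes
    one of the [b.+1] counts vanish; the induction hypothesis bounds the
    others. *)
Lemma count_without_cell_AP (F : pred nat) (b m : nat) :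
  0 < m -> ~ has_cell_AP F b.+1 m ->
  forall n a, count F (iota a ((b.+1 * m) ^ n)) <= (m * b) ^ n.
Proof.
move=> m0 noAP; elim=> [|n IH] a.
  by rewrite !expn0 (leq_trans (count_size _ _)) ?size_iota.
rewrite expnS -mulnA count_iota_blocks.
set w := (b.+1 * m) ^ n.
under eq_bigr => x _ do rewrite count_iota_blocks.
rewrite exchange_big /= expnS -mulnA.
apply: (@leq_trans (\sum_(j < m) b * (m * b) ^ n)); last first.
  by rewrite sum_nat_const card_ord.
apply: leq_sum => j _.
have [[x /eqP x0]|allF] := pselect (exists x : 'I_b.+1,
    count F (iota (a + x * (m * w) + j * w) w) == 0).
  by apply: (sum_bounded_one_zero _ _ _ x) => // y; apply: IH.
case: noAP; exists (a + j * w), w; split; first by rewrite expn_gt0 muln_gt0 m0.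
(* A point in each cell of offset [j]; 0 is a junk value for [x > b]. *)
have pick x : exists q, x < b.+1 ->
    [/\ F q, a + j * w + x * (m * w) <= q & q < a + j * w + x * (m * w) + w].
  case: (ltnP x b.+1) => [xb|]; last by exists 0.
  have : has F (iota (a + x * (m * w) + j * w) w).
    rewrite has_count lt0n; apply/negP => c0.
    by apply: allF; exists (Ordinal xb).
  case/hasP=> q; rewrite mem_iota addnAC => /andP[q1 q2] Fq.
  by exists q.
by have [f fP] := choice pick; exists f.
Qed.

(** * Counting the primes of prime index *)

Definition prime_pi (x : nat) : nat := count prime (iota 0 x).

Lemma prime_piS x : prime_pi x.+1 = prime_pi x + prime x.
Proof. by rewrite /prime_pi -addn1 iotaD count_cat /= add0n addn0. Qed.

Lemma leq_prime_pi : {homo prime_pi : x y / x <= y}.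
Proof.
move=> x y /subnKC <-; elim: (y - x) => [|d IH]; first by rewrite addn0.
by rewrite addnS prime_piS (leq_trans IH) ?leq_addr.
Qed.

Lemma prime_pi_leq x : prime_pi x <= x.
Proof. by rewrite /prime_pi (leq_trans (count_size _ _)) ?size_iota. Qed.

Lemma nth_prime_prime_pi p : prime p -> nth_prime (prime_pi p).+1 = p.
Proof.
move=> pp; have [pq] := @nth_primeP (prime_pi p).+1 isT.
rewrite -/(prime_pi _) /= => eq_pi.
have lt_pi x y : prime x -> x < y -> prime_pi x < prime_pi y.
  by move=> px /leq_prime_pi; rewrite prime_piS px addn1.
have [lt|lt|//] := ltngtP (nth_prime (prime_pi p).+1) p.
  by have := lt_pi _ _ pq lt; rewrite eq_pi ltnn.
by have := lt_pi _ _ pp lt; rewrite eq_pi ltnn.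
Qed.

(** A prime [q] has index [(prime_pi q).+1], since [prime_pi] counts the primes
    strictly below its argument. *)
Definition prime_of_prime_index (q : nat) : bool :=
  prime q && prime (prime_pi q).+1.

Lemma prime_of_prime_indexP q : prime_of_prime_index q ->
  exists2 n, 0 < n & nth_prime (nth_prime n) = q.
Proof.
case/andP=> pq pi; exists (prime_pi (prime_pi q).+1).+1 => //.
by rewrite !nth_prime_prime_pi.
Qed.

(** When [x] passes a prime, [prime_pi x] grows by one, and the right-hand side
    grows exactly when the index of that prime is itself prime. *)
Lemma count_prime_of_prime_index x :
  count prime_of_prime_index (iota 0 x) = prime_pi (prime_pi x).+1.
Proof.
elim: x => [//|x IH].
rewrite -addn1 iotaD count_cat IH /= add0n addn0 addn1 [prime_pi x.+1]prime_piS.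
rewrite /prime_of_prime_index; case: (prime x) => /=; last by rewrite !addn0.
by rewrite addn1 [in RHS]prime_piS.
Qed.

(** * A Chebyshev lower bound for the number of primes *)

(** By Legendre's formula the valuation is the sum over [i] of
    [n.*2 %/ p ^ i - (n %/ p ^ i).*2]. Each term is at most 1 and vanishes when
    [p ^ i > n.*2], so there are at most [trunc_log p n.*2] nonzero terms. *)
Lemma pfactor_central_bin p n : prime p -> 0 < n ->
  p ^ logn p 'C(n.*2, n) <= n.*2.
Proof.
move=> pp n0; have p1 := prime_gt1 pp; have p0 := prime_gt0 pp.
have n20 : 0 < n.*2 by rewrite double_gt0.
have le_n : n <= n.*2 by rewrite -addnn leq_addr.
apply: leq_trans (trunc_logP p1 n20); rewrite leq_exp2l //.
set T := trunc_log p n.*2.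
have := congr1 (logn p) (bin_fact le_n).
rewrite -{2}addnn addnK !lognM ?muln_gt0 ?fact_gt0 ?bin_gt0 // !logn_fact //.
have -> : \sum_(1 <= i < n.+1) n %/ p ^ i = \sum_(1 <= i < n.*2.+1) n %/ p ^ i.
  rewrite [RHS](@big_cat_nat _ _ _ n.+1) //= [X in _ = _ + X]big_nat [X in _ = _ + X]big1 ?addn0 //.
  move=> i /andP[ni _]; rewrite divn_small //.
  exact: ltn_trans ni (ltn_expl _ p1).
have : \sum_(1 <= i < n.*2.+1) n.*2 %/ p ^ i <=
    \sum_(1 <= i < n.*2.+1) ((n %/ p ^ i).*2 + (i <= T)).
  apply: leq_sum => i _; have pi0 : 0 < p ^ i by rewrite expn_gt0 p0.
  have [iT|Ti] := leqP i T.
    by rewrite -addnn -addnn; apply: leq_divDl.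
  rewrite divn_small // (leq_trans (trunc_log_ltn n.*2 p1)) //.
  by rewrite leq_exp2l.
have sumT N : \sum_(1 <= i < N.+1) (i <= T) <= T.
  suff -> : \sum_(1 <= i < N.+1) (i <= T) = minn N T by rewrite geq_minr.
  elim: N => [|N IH]; first by rewrite big_nil min0n.
  by rewrite big_nat_recr //= IH; lia.
rewrite big_split /=; have := sumT n.*2.
under [X in _ <= X + _ -> _]eq_bigr => i _ do rewrite -addnn.
rewrite big_split /=; lia.
Qed.

(** Each prime factor of the coefficient is at most [n.*2], and contributes a
    prime power that is at most [n.*2] as well. *)
Lemma central_bin_leq n : 0 < n ->
  'C(n.*2, n) <= n.*2 ^ prime_pi n.*2.+1.
Proof.
move=> n0; have le_n : n <= n.*2 by rewrite -addnn leq_addr.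
have n20 : 0 < n.*2 by rewrite double_gt0.
set C := 'C(n.*2, n); have C0 : 0 < C by rewrite bin_gt0.
rewrite {1}(prod_prime_decomp C0) prime_decompE big_map /=.
apply: (@leq_trans (\prod_(p <- primes C) n.*2)).
  rewrite big_seq [leqRHS]big_seq; apply: leq_prod => p.
  by rewrite mem_primes => /and3P[pp _ _]; apply: pfactor_central_bin.
rewrite big_const_seq count_predT iter_muln_1 leq_pexp2l // /prime_pi -size_filter.
apply: uniq_leq_size => [|p pC]; first exact: primes_uniq.
move: (pC); rewrite mem_primes mem_filter mem_iota => /and3P[pp _ _].
rewrite pp /= add0n ltnS; apply: leq_trans (pfactor_central_bin p n pp n0).
by rewrite -{1}(expn1 p) leq_exp2l ?prime_gt1 // logn_gt0.
Qed.

Lemma central_bin_geq n : 2 ^ n <= 'C(n.*2, n).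
Proof.
elim: n => [|n IH]; first by rewrite bin0.
rewrite expnS doubleS binS (leq_trans (leq_mul (leqnn 2) IH)) //.
rewrite mul2n -addnn; apply: leq_add.
  by rewrite binS leq_addl.
by rewrite leq_bin2l.
Qed.

Lemma leq_expl (m n e : nat) : m <= n -> m ^ e <= n ^ e.
Proof. by case: e => // e; rewrite leq_exp2r. Qed.

(** The two bounds on the central binomial coefficient give
    [2 ^ n <= n.*2 ^ prime_pi n.*2.+1 <= 2 ^ (e * prime_pi x)] for the largest
    [n] with [n.*2 < x]. The exponent [e] stands for a logarithm of [x]. *)
Lemma prime_pi_lower x e : x <= 2 ^ e -> x <= 2 * (e * prime_pi x).+1.
Proof.
move=> xe; have [|n0] := posnP x.-1./2; first by lia.
set n := x.-1./2 in n0 *.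
have nx : n.*2.+1 <= x by rewrite /n; lia.
suff : n <= e * prime_pi x by rewrite /n; lia.
rewrite -(@leq_exp2l 2) // expnM.
apply: leq_trans (central_bin_geq n) _; apply: leq_trans (central_bin_leq n n0) _.
apply: (@leq_trans ((2 ^ e) ^ prime_pi n.*2.+1)).
  by apply: leq_expl; lia.
by rewrite leq_pexp2l ?expn_gt0 // leq_prime_pi.
Qed.

(** * Density of the primes of prime index *)

(** The cube of Bernoulli's inequality: [(1 + 1 / b) ^ s >= s / b] makes
    [(1 + 1 / b) ^ (3 * s)] grow at least like [s ^ 3], faster than a square. *)
Lemma exp_beats_square (b c : nat) : 0 < b ->
  exists2 n, 0 < n & c * n ^ 2 * b ^ n < b.+1 ^ n.
Proof.
move=> b0.
have bern s : s * b ^ s <= b * b.+1 ^ s.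
  elim: s => [//|s IH].
  have : b ^ s <= b.+1 ^ s by rewrite leq_expl.
  rewrite !expnS; nia.
(* The inequality to refute reduces to [s <= 9 * c * b ^ 3]. *)
set s := (9 * c * b ^ 3).+1; exists (3 * s); first by [].
rewrite ltnNge; apply/negP => H.
have : (s * b ^ s) ^ 3 <= (b * b.+1 ^ s) ^ 3 by rewrite leq_expl.
rewrite !expnMn -!expnM [s * 3]mulnC => H3.
have : s ^ 3 * b ^ (3 * s) <= b ^ 3 * (c * (3 * s) ^ 2) * b ^ (3 * s).
  by rewrite (leq_trans H3) // -[leqRHS]mulnA leq_mul2l H orbT.
rewrite leq_pmul2r ?expn_gt0 ?b0 // => {H H3}.
have s0 : 0 < s ^ 2 by rewrite expn_gt0.
have -> : b ^ 3 * (c * (3 * s) ^ 2) = (9 * c * b ^ 3) * s ^ 2.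
  by rewrite expnMn; lia.
by rewrite expnS leq_pmul2r // ltnn.
Qed.


(** If the count were at most [B], the Chebyshev bound, used twice with [e * n]
    for the logarithm of [X = e ^ n], would give [X <= 12 * (e * n) ^ 2 * B];
    divided by [m ^ n], this contradicts [exp_beats_square]. *)
Lemma prime_of_prime_index_dense (b m : nat) : 0 < b -> 0 < m ->
  exists n,
    (m * b) ^ n < count prime_of_prime_index (iota 0 ((b.+1 * m) ^ n)).
Proof.
move=> b0 m0; set e := b.+1 * m.
have e0 : 0 < e by rewrite muln_gt0.
have [n n0 growth] := exp_beats_square b (12 * e ^ 2) b0.
exists n; rewrite ltnNge; apply/negP; rewrite count_prime_of_prime_index.
set X := e ^ n; set B := (m * b) ^ n => few.
have B0 : 0 < B by rewrite expn_gt0 muln_gt0 m0 b0.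
have Xe : X <= 2 ^ (e * n) by rewrite expnM leq_expl // ltnW // ltn_expl.
have YX := prime_pi_leq X.
have l1 := prime_pi_lower X _ Xe.
have l2 := prime_pi_lower (prime_pi X) _ (leq_trans YX Xe).
have := leq_prime_pi _ _ (leqnSn (prime_pi X)).
have N0 : 0 < e * n by rewrite muln_gt0 e0.
move=> /leq_trans/(_ few) few'.
have l3 : prime_pi X <= 2 * (e * n * B).+1.
  by apply: (leq_trans l2); rewrite leq_mul2l ltnS leq_mul2l few' orbT.
have l4 : X <= 2 * (e * n * (2 * (e * n * B).+1)).+1.
  by apply: (leq_trans l1); rewrite leq_mul2l ltnS leq_mul2l l3 orbT.
have : X <= 12 * e ^ 2 * n ^ 2 * B.
  have -> : 12 * e ^ 2 * n ^ 2 * B = 12 * ((e * n) ^ 2 * B).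
    by rewrite expnMn !mulnA.
  apply: (leq_trans l4).
  move: (e * n) N0 => N N0; rewrite -mulnn.
  have : N <= N * N by rewrite leq_pmull.
  have : 1 <= N * N by rewrite muln_gt0 N0.
  move: (N * N) (mulnA N N B) => N2 E h1 h2.
  have : N2 <= N2 * B by rewrite leq_pmulr.
  have -> : N * (2 * (N * B).+1) = 2 * (N2 * B) + 2 * N by rewrite -E; lia.
  lia.
apply/negP; rewrite -ltnNge.
have -> : X = m ^ n * b.+1 ^ n by rewrite /X /e expnMn mulnC.
by rewrite /B expnMn mulnCA ltn_pmul2l ?expn_gt0 ?m0.
Qed.

End Counting.

(** * Approximate progressions of real numbers *)

(** The progression of left ends, [t = a] and [Delta = m * w], is matched
    with the chosen points up to an error below [w <= eps * Delta]. The cells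
    are disjoint, so the points are distinct and their number is [k]. *)
Lemma approx_AP_of_cell_AP (R : realType) (F : pred nat) (k m : nat) (eps : R) :
  (0 < k)%N -> eps^-1 < m%:R -> 0 < eps -> has_cell_AP F k m ->
  contains_approx_AP k eps [set q%:R | q in [set q | F q]]%classic.
Proof.
move=> k0 epsm eps0 [a [w [w0 [f fP]]]].
have w0R : 0 < w%:R :> R by rewrite ltr0n.
have m0R : 0 < m%:R :> R by apply: lt_trans epsm; rewrite invr_gt0.
have m0 : (0 < m)%N by rewrite -(ltr0n R).
have D0 : 0 < (m * w)%:R :> R by rewrite ltr0n muln_gt0 m0.
have f_lt x y : (x < k)%N -> (y < k)%N -> (x < y)%N -> (f x < f y)%N.
  move=> xk yk xy; have [_ _ fx] := fP _ xk; have [_ fy _] := fP _ yk.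
  apply: leq_trans fx (leq_trans _ fy); rewrite -addnA leq_add2l.
  by apply: (@leq_trans (x.+1 * (m * w))); nia.
have f_inj : {in `I_k &, injective (fun x => (f x)%:R : R)}%classic.
  move=> x y; rewrite !inE /= => xk yk /eqP; rewrite eqr_nat => /eqP fxy.
  have [/f_lt lt|/f_lt lt|//] := ltngtP x y.
    by have := lt xk yk; rewrite fxy ltnn.
  by have := lt yk xk; rewrite fxy ltnn.
exists [set (f x)%:R | x in `I_k]%classic.
  by move=> _ [x /fP[Ffx _ _] <-]; exists (f x).
exists a%:R, (m * w)%:R; split=> //.
  apply: card_eq_trans (inj_card_eq f_inj) _; rewrite card_eq_sym.
  apply: inj_card_eq => x y _ _ /addrI /(mulfI (lt0r_neq0 D0)) /eqP.
  by rewrite eqr_nat => /eqP.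
apply: ge_sup.
  by eexists; exists (a%:R + (m * w)%:R * 0%:R) => //; exists 0%N.
move=> _ [_ [x xk <-] <-].
have [_ lo hi] := fP _ xk.
apply: (@le_trans _ _ `|a%:R + (m * w)%:R * x%:R - (f x)%:R|).
  apply: ge_inf; first by exists 0 => _ [y _ <-].
  by exists (f x)%:R => //; exists x.
have -> : a%:R + (m * w)%:R * x%:R - (f x)%:R =
    - (f x - (a + x * (m * w)))%:R :> R.
  by rewrite natrB // natrD [(x * _)%:R]natrM [x%:R * _]mulrC opprB.
rewrite normrN normr_nat; apply: (@le_trans _ _ w%:R).
  by rewrite ler_nat; lia.
rewrite natrM mulrA; apply: ler_peMl; first exact: ltW.
by rewrite -[leLHS](mulfV (lt0r_neq0 eps0)) ler_pM2l // ltW.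
Qed.

(** The hypothesis only negates the bound of [count_without_cell_AP] for one
    interval at each [m]. *)
Lemma contains_approx_AP_of_dense (R : realType) (F : pred nat) (b : nat) :
  (forall m, (0 < m)%N ->
    exists n, ((m * b) ^ n < count F (iota 0 ((b.+1 * m) ^ n)))%N) ->
  forall eps : R, 0 < eps ->
    contains_approx_AP b.+1 eps [set q%:R | q in [set q | F q]]%classic.
Proof.
move=> dense eps eps0; set m := Num.bound eps^-1.
have epsm : eps^-1 < m%:R by rewrite archi_boundP // invr_ge0 ltW.
have m0 : (0 < m)%N.
  by rewrite -(ltr0n R); apply: lt_trans epsm; rewrite invr_gt0.
apply: (approx_AP_of_cell_AP _ _ _ m) => //; apply: contrapT => noAP.
by have [n] := dense m m0; rewrite ltnNge count_without_cell_AP.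
Qed.

Theorem mainTheorem7 (R : realType) (k : nat) (eps : R)
    (hk : (3 <= k)%N) (heps : 0 < eps) :
  contains_approx_AP k eps (prime_indexed_primes R).
Proof.
case: k hk => // b hb.
have b0 : (0 < b)%N by case: b hb.
have [Q QF QAP] := contains_approx_AP_of_dense R prime_of_prime_index b
  (fun m => prime_of_prime_index_dense b m b0) eps heps.
exists Q => // q /QF[_ /prime_of_prime_indexP[n n0 <-] <-].
by exists n.
Qed.
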